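(* Let $T$ be an irreducible, minimum-cost two-way-comparison decision tree for an instance $(Q,w,\mathcal C,K)$. Let $u_1\to u_2\to\cdots\to u_d$ be any downward path in $T$ (not necessarily starting at the root), and let $u_2'$ denote the sibling of $u_2$. Suppose $w(u_2')<w(u_d)$. Then for all distinct indices $i,j$ with $i,j<d$, both outcomes at $u_i$ are consistent with the outcome $u_j\to u_{j+1}$.
   Context: An instance $(Q,w,\mathcal C,K)$ consists of a totally ordered finite set $Q$ of queries, each with a weight $w(q)\ge 0$; a collection $\mathcal C\subseteq 2^Q$ of classes; and a set $K\subseteq Q$ of keys; every query belongs to some class. An allowed test is ''$q<k$'' for some $k\in K$ with $\min Q<k\le\max Q$, or ''$q=k$'' for some $k\in K$. A two-way-comparison decision tree is a rooted binary tree whose non-leaf nodes are allowed tests, with children labeled by the outcomes yes/no, and whose leaves are labeled by classes in $\mathcal C$, each leaf's class containing every query whose search ends there. The search for $q$ starts at the root and moves to the yes-child if $q$ satisfies the test and to the no-child otherwise; $q$ reaches every node on its search path; its depth is the number of tests on the path; the cost of the tree is $\sum_q w(q)\,\mathrm{depth}(q)$. The query set $Q_u$ of a node $u$ is the set of queries reaching $u$, and $w(u)=\sum_{q\in Q_u}w(q)$. The tree is irreducible if for every node $u$, (i) at least one query reaches $u$, and (ii) if some class contains all of $Q_u$ then $u$ is a leaf. Each edge $u\to v$ from a test node to a child is identified with the corresponding outcome of the test at $u$. Two outcomes (of tests, possibly at different nodes) are consistent if some query in $Q$ satisfies both, and inconsistent otherwise. *)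

(* Defs.v *)
From HB Require Import structures.
From mathcomp Require Import all_boot all_order all_algebra.

Set Implicit Arguments.
Unset Strict Implicit.
Unset Printing Implicit Defensive.

Import Order.TTheory GRing.Theory Num.Theory.
Local Open Scope ring_scope.

(* The query set is the whole finite totally ordered type Q. *)
Record instance (R : realDomainType) (disp : Order.disp_t)
    (Q : finOrderType disp) := Instance {
  weight : Q -> R;
  classes : {set {set Q}};
  keys : {set Q};
  weight_ge0 : forall q, 0 <= weight q;
  classes_cover : forall q, exists2 c, c \in classes & q \in c
}.

Section Trees.
Context {disp : Order.disp_t} {Q : finOrderType disp}.

Inductive test := LtTest of Q | EqTest of Q.

Definition satisfies (t : test) (q : Q) : bool :=
  match t with
  | LtTest k => (q < k)%O
  | EqTest k => q == k
  end.

(* An outcome (t, true) is the answer yes to t, and (t, false) the answer no. *)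
Definition outcome : Type := (test * bool)%type.

Definition satisfies_outcome (o : outcome) (q : Q) : bool :=
  satisfies o.1 q == o.2.

Definition consistent (o1 o2 : outcome) : Prop :=
  exists q : Q, satisfies_outcome o1 q /\ satisfies_outcome o2 q.

(* [Node t Ty Tn] has yes-child [Ty] and no-child [Tn]. *)
Inductive tree := Leaf of {set Q} | Node of test & tree & tree.

(* A node is named by the answers leading to it from the root ([true] = yes). *)
Definition node : Type := seq bool.

Fixpoint subtree (T : tree) (u : node) : option tree :=
  match u, T with
  | [::], _ => Some T
  | b :: u', Node _ Ty Tn => subtree (if b then Ty else Tn) u'
  | _ :: _, Leaf _ => None
  end.

Definition is_node (T : tree) (u : node) : bool := isSome (subtree T u).

Definition is_leaf (T : tree) (u : node) : bool :=
  if subtree T u is Some (Leaf _) then true else false.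

Definition edge_outcome (T : tree) (u v : node) : option outcome :=
  if subtree T u is Some (Node t _ _) then
    if v == rcons u true then Some (t, true)
    else if v == rcons u false then Some (t, false)
    else None
  else None.

Definition child (T : tree) (u v : node) : bool := isSome (edge_outcome T u v).

Definition sibling (T : tree) (v v' : node) : Prop :=
  v != v' /\ exists u, child T u v /\ child T u v'.

(* The leaf at which the search for q ends; its prefixes are exactly the nodes
   that q reaches. *)
Fixpoint search (T : tree) (q : Q) : node :=
  match T with
  | Leaf _ => [::]
  | Node t Ty Tn =>
      satisfies t q :: (if satisfies t q then search Ty q else search Tn q)
  end.

Definition depth (T : tree) (q : Q) : nat := size (search T q).

Definition queries_at (T : tree) (u : node) : {set Q} :=
  [set q | prefix u (search T q)].

End Trees.

Arguments test {disp} Q.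
Arguments outcome {disp} Q.
Arguments tree {disp} Q.

Section Instances.
Context {R : realDomainType} {disp : Order.disp_t} {Q : finOrderType disp}.
Context (I : instance R Q).

(* k is also the default element required by [arg min] and [arg max]. *)
Definition allowed (t : test Q) : bool :=
  match t with
  | LtTest k => (k \in keys I) &&
      ([arg min_(q < k) q] < k <= [arg max_(q > k) q])%O
  | EqTest k => k \in keys I
  end.

Definition decision_tree (T : tree Q) : Prop :=
  forall u : node,
    match subtree T u with
    | Some (Leaf c) => c \in classes I /\ forall q, search T q = u -> q \in c
    | Some (Node t _ _) => allowed t
    | None => True
    end.

Definition cost (T : tree Q) : R := \sum_q weight I q * (depth T q)%:R.

Definition node_weight (T : tree Q) (u : node) : R :=
  \sum_(q in queries_at T u) weight I q.

Definition irreducible (T : tree Q) : Prop :=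
  forall u : node, is_node T u ->
    (exists q, q \in queries_at T u) /\
    ((exists2 c, c \in classes I & queries_at T u \subset c) -> is_leaf T u).

Definition minimum_cost (T : tree Q) : Prop :=
  forall T' : tree Q, decision_tree T' -> cost T <= cost T'.

End Instances.

(* Main.v *)
(* Two tests always have a pair of inconsistent outcomes. Let S_i be the set of
   queries satisfying the outcome u_i -> u_{i+1}. If the complement of S_1 misses
   that of S_2, moving the second test above the first shows
   w(u_3') <= w(u_2'), so the weight hypothesis passes to u_2 -> ... -> u_d, and
   by induction the claim holds there; hence the complements of S_2, ...,
   S_{d-1} are pairwise disjoint. If then the complement of S_1 missed S_j, the
   j-th test could be moved above the first one, changing the cost by at most
   w(u_2') - w(u_d) < 0. *)
Require Import Defs.
From mathcomp Require Import all_boot all_order all_algebra.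
From mathcomp Require Import zify.

Set Implicit Arguments.
Unset Strict Implicit.
Unset Printing Implicit Defensive.

Import Order.TTheory GRing.Theory Num.Theory.
Local Open Scope ring_scope.

(** * Consistency of pairs of outcomes *)

Section Outcomes.
Context {disp : Order.disp_t} {Q : finOrderType disp}.
Implicit Types (o : outcome Q) (q : Q).

Definition meets o1 o2 : bool :=
  [exists q, satisfies_outcome o1 q && satisfies_outcome o2 q].

Lemma meetsP o1 o2 : reflect (consistent o1 o2) (meets o1 o2).
Proof.
by apply: (iffP existsP) => -[q]; [move/andP | move=> /andP]; exists q.
Qed.

Definition opposite o : outcome Q := (o.1, ~~ o.2).

Lemma satisfies_opposite o q :
  satisfies_outcome (opposite o) q = ~~ satisfies_outcome o q.
Proof. by rewrite /satisfies_outcome /=; case: (satisfies _ _) o.2 => [] []. Qed.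

(** The queries answering yes to a test form an initial segment or a singleton, and two such sets
    are nested or disjoint. If nested, yes to the smaller excludes no to the larger; if disjoint,
    the two yes answers clash. *)
Lemma tests_clash (s t : test Q) : exists a b, ~~ meets (s, a) (t, b).
Proof.
suff [a [b H]] : exists a b, forall q, satisfies s q = a -> satisfies t q != b.
  exists a, b; apply/existsP => -[q /andP[/eqP /= sa /eqP /= tb]].
  by have := H q sa; rewrite tb eqxx.
case: s t => [k|k] [m|m] /=.
- have [le_km|/ltW le_mk] := leP k m.
    by exists true, false => q qk; rewrite (lt_le_trans qk le_km).
  by exists false, true => q /negbT; rewrite -leNgt ltNge => /(le_trans le_mk) ->.
- have [lt_mk|le_km] := ltP m k.
    by exists false, true => q; have [->|//] := eqVneq q m; rewrite lt_mk.
  by exists true, true => q; have [->|//] := eqVneq q m; rewrite ltNge le_km.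
- have [lt_km|le_mk] := ltP k m.
    by exists true, false => q /eqP ->; rewrite lt_km.
  by exists true, true => q /eqP ->; rewrite ltNge le_mk.
- have [->|ne_km] := eqVneq k m.
    by exists true, false => q ->.
  by exists true, true => q /eqP ->; rewrite (negPf ne_km).
Qed.

(** By [tests_clash] one of the four pairs of outcomes is inconsistent, and the hypotheses exclude
    three of them. *)
Lemma opposite_meets o1 o2 : meets o1 o2 -> meets o1 (opposite o2) ->
  meets (opposite o1) o2 -> ~~ meets (opposite o1) (opposite o2).
Proof.
case: o1 o2 => [s a] [t b] /=; have [a' [b']] := tests_clash s t.
rewrite /opposite /=.
by case: a a' b b' => [] [] [] [] /negPf H; rewrite ?H.
Qed.

Lemma not_meets o1 o2 q : ~~ meets o1 o2 ->
  satisfies_outcome o1 q -> satisfies_outcome o2 q = false.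
Proof.
by move=> /existsPn/(_ q); rewrite negb_and => /orP[/negPf -> //|/negPf].
Qed.

End Outcomes.

Lemma all_splits (A : Type) (P : pred A) (s : seq A) :
  (forall s1 x s2, s = s1 ++ x :: s2 -> P x) -> all P s.
Proof.
elim: s => //= x s IHs H; rewrite (H [::] x s) //=.
by apply: IHs => s1 y s2 sE; apply: (H (x :: s1) y s2); rewrite sE.
Qed.

(** * Trees seen as a downward path with subtrees hanging off it *)

Section Spines.
Context {disp : Order.disp_t} {Q : finOrderType disp}.
Implicit Types (T x y C D : tree Q) (o : outcome Q) (q : Q) (X : {set Q}).

(** Naming the followed outcome instead of yes and no spares a case split on the answer whenever
    tests are rearranged. *)
Definition branch o x y : tree Q :=
  if o.2 then Node o.1 x y else Node o.1 y x.

Lemma branch_opposite o x y : branch (opposite o) x y = branch o y x.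
Proof. by rewrite /branch /=; case: o.2. Qed.

Lemma search_branch o x y q : search (branch o x y) q =
  satisfies o.1 q ::
    (if satisfies_outcome o q then search x q else search y q).
Proof.
by case: o => t []; rewrite /satisfies_outcome /=; case: (satisfies t q).
Qed.

Lemma depth_branch o x y q : depth (branch o x y) q =
  (if satisfies_outcome o q then depth x q else depth y q).+1.
Proof. by rewrite /depth search_branch /=; case: ifP. Qed.

(** Independent of the position of the leaf, so the answers given before and after a rearrangement
    can be compared. *)
Fixpoint label T q : {set Q} :=
  match T with
  | Leaf c => c
  | Node t Ty Tn => if satisfies t q then label Ty q else label Tn q
  end.

Lemma label_branch o x y q : label (branch o x y) q =
  if satisfies_outcome o q then label x q else label y q.
Proof.
by case: o => t []; rewrite /satisfies_outcome /=; case: (satisfies t q).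
Qed.

Lemma subtree_search T q : subtree T (search T q) = Some (Leaf (label T q)).
Proof. by elim: T => //= t Ty IHy Tn IHn; case: (satisfies t q). Qed.

Lemma subtree_root T : subtree T [::] = Some T.
Proof. by case: T. Qed.

Lemma is_node_root T : is_node T [::].
Proof. by case: T. Qed.

Lemma subtree_cat T u v :
  subtree T (u ++ v) = obind (fun x => subtree x v) (subtree T u).
Proof. by elim: u T => [|b u IHu] [c|t Ty Tn] /=. Qed.

(* A spine lists, along a downward path, the outcome followed at each node and
   the subtree hanging off the other outcome. *)
Definition build (s : seq (outcome Q * tree Q)) C : tree Q :=
  foldr (fun p x => branch p.1 x p.2) C s.

Definition follows (s : seq (outcome Q * tree Q)) q : bool :=
  all (fun p => satisfies_outcome p.1 q) s.

Lemma label_build s C q : follows s q -> label (build s C) q = label C q.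
Proof.
by elim: s => //= p s IHs /andP[pq sq]; rewrite label_branch pq IHs.
Qed.

Lemma depth_build s C q :
  follows s q -> depth (build s C) q = (size s + depth C q)%N.
Proof.
by elim: s => //= p s IHs /andP[pq sq]; rewrite depth_branch pq IHs.
Qed.

Lemma label_build_branch s o C D q : satisfies_outcome o q ->
  label (build s (branch o C D)) q = label (build s C) q.
Proof. by move=> oq; elim: s => [|p s IHs] /=; rewrite !label_branch ?oq ?IHs. Qed.

(** For a query with outcome [o], a test grafted above [C] costs one comparison exactly when the
    search gets that far, that is, follows [s]. *)
Lemma depth_build_branch s o C D q : satisfies_outcome o q ->
  depth (build s (branch o C D)) q = (depth (build s C) q + follows s q)%N.
Proof.
move=> oq; elim: s => [|p s IHs] /=; first by rewrite depth_branch oq addn1.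
by rewrite !depth_branch; case: ifP; rewrite ?IHs ?addSn ?addn0.
Qed.

(** The walk stops silently at a leaf, so the result is as long as [bs] only when [bs] names a
    node. *)
Fixpoint spine T (bs : seq bool) : seq (outcome Q * tree Q) :=
  match bs, T with
  | b :: bs', Node t Ty Tn =>
      ((t, b), if b then Tn else Ty) :: spine (if b then Ty else Tn) bs'
  | _, _ => [::]
  end.

Lemma build_spine T bs C : subtree T bs = Some C -> T = build (spine T bs) C.
Proof.
elim: bs T => [|b bs IHbs] [c|t Ty Tn] //=; [by case | by case |].
by move=> /IHbs; case: b => /= <-.
Qed.

Lemma size_spine T bs : is_node T bs -> size (spine T bs) = size bs.
Proof.
rewrite /is_node; elim: bs T => [|b bs IHbs] [c|t Ty Tn] //=.
by move=> /IHbs ->.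
Qed.

Lemma prefix_search T bs q :
  is_node T bs -> prefix bs (search T q) = follows (spine T bs) q.
Proof.
rewrite /is_node; elim: bs T => [|b bs IHbs] [c|t Ty Tn] //= Tbs.
rewrite /satisfies_outcome /=.
by case: b Tbs => /IHbs IH; case: (satisfies t q) => //=; rewrite IH.
Qed.

Lemma nth_spine T bs i p t Ty Tn : is_node T bs -> (i < size bs)%N ->
  subtree T (take i bs) = Some (Node t Ty Tn) ->
  (nth p (spine T bs) i).1 = (t, nth true bs i).
Proof.
rewrite /is_node; elim: i T bs => [|i IHi] [c|s x y] [|b bs] //= Tbs lti.
  by case=> ->.
exact: IHi.
Qed.

(** Condition (i) of irreducibility relative to a query set, a form that passes to subtrees. *)
Definition inhabited T X : Prop :=
  forall u, is_node T u -> exists2 q, q \in X & prefix u (search T q).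

Lemma inhabited_branch o x y X : inhabited (branch o x y) X ->
  inhabited x [set q in X | satisfies_outcome o q].
Proof.
move=> H u xu; have [|q Xq] := H (o.2 :: u).
  by move: xu; rewrite /branch /is_node; case: o.2.
rewrite search_branch /= eq_sym => /andP[oq]; exists q => //.
- by rewrite inE Xq.
- by move: b; rewrite /satisfies_outcome oq.
Qed.

Lemma inhabited_build s C X : inhabited (build s C) X ->
  inhabited C [set q in X | follows s q].
Proof.
elim: s X => [|p s IHs] X /= H.
  by rewrite (_ : [set _ | _] = X) //; apply/setP => q; rewrite inE andbT.
have /IHs := inhabited_branch H.
by congr inhabited; apply/setP => q; rewrite !inE andbA.
Qed.

End Spines.

(** * Optimality of subtrees and the exchange argument *)

Section Optimality.
Context {R : realDomainType} {disp : Order.disp_t} {Q : finOrderType disp}.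
Context (I : instance R Q).
Implicit Types (T x y C D : tree Q) (o : outcome Q) (q : Q) (X : {set Q}).
Implicit Types (s m : seq (outcome Q * tree Q)).

Fixpoint well_formed T : bool :=
  match T with
  | Leaf c => c \in classes I
  | Node t Ty Tn => [&& allowed I t, well_formed Ty & well_formed Tn]
  end.

Lemma well_formed_branch o x y : well_formed (branch o x y) =
  [&& allowed I o.1, well_formed x & well_formed y].
Proof.
by rewrite /branch; case: o.2 => /=; rewrite ?[well_formed y && _]andbC.
Qed.

Lemma well_formed_build s C : well_formed (build s C) =
  all (fun p => allowed I p.1.1 && well_formed p.2) s && well_formed C.
Proof.
elim: s => //= p s IHs; rewrite well_formed_branch IHs.
by rewrite -!andbA; congr (_ && _); rewrite andbA andbC.
Qed.

(** A subtree has to answer only the queries that reach its root, hence the restriction to [X]. *)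
Definition correct T X : Prop := well_formed T /\ {in X, forall q, q \in label T q}.

Definition weight_on X : R := \sum_(q in X) weight I q.

Lemma sum_setId X (P : pred Q) (F : Q -> R) :
  \sum_(q in [set q in X | P q]) F q = \sum_(q in X) if P q then F q else 0.
Proof. by rewrite -big_mkcondr; apply: eq_bigl => q; rewrite inE. Qed.

Lemma weight_onS X (Y : {set Q}) : X \subset Y -> weight_on X <= weight_on Y.
Proof.
move=> sXY; rewrite /weight_on [leRHS](big_setID X) /= (setIidPr sXY) lerDl.
by apply: sumr_ge0 => q _; apply: weight_ge0.
Qed.

Definition cost_on T X : R := \sum_(q in X) weight I q * (depth T q)%:R.

Definition optimal T X : Prop :=
  correct T X /\ forall T', correct T' X -> cost_on T X <= cost_on T' X.

Lemma decision_treeP T : decision_tree I T <-> correct T setT.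
Proof.
split=> [H | [wfT labT] u].
- split=> [|q _].
    (* The leaf clause on queries refers to searches from the root of [T]; dropping it lets the
       induction pass to subtrees. *)
    have {}H u : match subtree T u with
      | Some (Leaf c) => c \in classes I
      | Some (Node t _ _) => allowed I t
      | None => true end.
      by move: (H u); case: (subtree T u) => [[c [] |]|].
    elim: T H => [c /(_ [::]) //|t Ty IHy Tn IHn H] /=.
    rewrite (H [::]) IHy ?IHn // => u; [exact: (H (false :: u)) | exact: (H (true :: u))].
  by have := H (search T q); rewrite subtree_search => -[_]; apply.
- have : if subtree T u is Some U then well_formed U else true.
    elim: u T wfT {labT} => [|b u IHu] [c|t Ty Tn] //= /and3P[_ wfy wfn].
    by apply: IHu; case: b.
  case Tu: (subtree T u) => [[c|t Ty Tn]|] //=; last by case/and3P.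
  move=> cI; split=> // q qu; have := labT q (in_setT q).
  by move: Tu; rewrite -qu subtree_search => -[->].
Qed.

Lemma optimal_root T :
  decision_tree I T -> minimum_cost I T -> optimal T setT.
Proof.
move=> /decision_treeP Tok Tmin; split=> // T' /decision_treeP/Tmin.
by rewrite /cost /cost_on !(eq_bigl _ _ (fun q => in_setT q)).
Qed.

Lemma cost_on_branch o x y X : cost_on (branch o x y) X =
  weight_on X + cost_on x [set q in X | satisfies_outcome o q]
    + cost_on y [set q in X | ~~ satisfies_outcome o q].
Proof.
rewrite /cost_on /weight_on !sum_setId -!big_split /=.
apply: eq_bigr => q _; rewrite depth_branch -nat1r mulrDr mulr1.
by case: ifP; rewrite ?addr0.
Qed.

(** Cut and paste: replacing [x] leaves the other terms of the cost unchanged, so a cheaper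
    replacement would improve the whole tree. *)
Lemma optimal_branch o x y X : optimal (branch o x y) X ->
  optimal x [set q in X | satisfies_outcome o q].
Proof.
move=> [[]]; rewrite well_formed_branch => /and3P[ot wfx wfy] lab min.
split=> [|x' [wfx' lab']].
  split=> // q; rewrite inE => /andP[/lab]; rewrite label_branch.
  by case: ifP.
have /min : correct (branch o x' y) X.
  split=> [|q Xq]; first by rewrite well_formed_branch ot wfx'.
  rewrite label_branch; case: ifPn => oq; first by apply: lab'; rewrite inE Xq.
  by have := lab q Xq; rewrite label_branch (negPf oq).
by rewrite !cost_on_branch lerD2r lerD2l.
Qed.

Lemma optimal_subtree T X u S : optimal T X -> subtree T u = Some S ->
  optimal S [set q in X | prefix u (search T q)].
Proof.
elim: u T X => [|b u IHu] T X Topt.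
  rewrite subtree_root => -[<-]; rewrite (_ : [set _ | _] = X) //.
  by apply/setP => q; rewrite inE prefix0s andbT.
case: T Topt => [c|t Ty Tn]; first by [].
pose x := if b then Ty else Tn; pose y := if b then Tn else Ty.
have -> : Node t Ty Tn = branch (t, b) x y by rewrite /x /y /branch; case: (b).
have -> : subtree (branch (t, b) x y) (b :: u) = subtree x u.
  by rewrite /branch /=; case: (b).
move=> /optimal_branch/IHu/[apply]; congr optimal; apply/setP => q.
rewrite !inE -andbA; congr (_ && _); rewrite search_branch /= eq_sym.
by rewrite /satisfies_outcome /=; case: eqP.
Qed.

(* Testing [o2] first costs one more comparison for the queries failing [o1]
   and saves one for those following the whole path. *)
Lemma exchange o1 o2 A1 A2 D m X :
  optimal (branch o1 (build m (branch o2 D A2)) A1) X ->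
  ~~ meets (opposite o1) o2 ->
  all (fun p => ~~ meets (opposite p.1) (opposite o2)) m ->
  weight_on [set q in X | [&& satisfies_outcome o1 q, follows m q
                            & satisfies_outcome o2 q]]
    <= weight_on [set q in X | ~~ satisfies_outcome o1 q].
Proof.
set T := branch o1 _ _ => -[[wfT labT] minT] no12 nom.
(* Queries failing [o2] skip [m] in the new tree; by [om] below they would have followed all of [m],
   so [o1] alone decides between [A2] and [A1]. *)
pose T' := branch o2 (build m D) (branch o1 A2 A1).
have o12 q : satisfies_outcome o2 q -> satisfies_outcome o1 q.
  move=> o2q; apply: contraTT o2q => o1q.
  by rewrite (not_meets no12) ?satisfies_opposite.
have om q : ~~ satisfies_outcome o2 q -> follows m q.
  move=> o2q; apply: sub_all nom => p nop.
  rewrite -[satisfies_outcome _ _]negbK -satisfies_opposite.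
  apply: contraNN o2q => /(not_meets nop).
  by rewrite satisfies_opposite => /negbFE.
have labE q : label T' q = label T q.
  rewrite !label_branch; case: ifPn => o2q.
    by rewrite o12 // label_build_branch.
  by case: ifP => // _; rewrite (label_build _ (om q o2q)) label_branch (negPf o2q).
(* Stated with additions on both sides to avoid truncated subtraction. Equality holds when [o2] is
   satisfied or [o1] fails; in the remaining case skipping [m] can only shorten the search. *)
have depthE q : (depth T' q + [&& satisfies_outcome o1 q, follows m q
      & satisfies_outcome o2 q] <= depth T q + ~~ satisfies_outcome o1 q)%N.
  rewrite !depth_branch; case: ifPn => o2q.
    by rewrite o12 // depth_build_branch //= andbT; lia.
  rewrite !andbF; case: ifP => o1q /=; last by lia.
  by rewrite (depth_build _ (om q o2q)) depth_branch (negPf o2q); lia.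
have /minT : correct T' X.
  split=> [|q /labT]; last by rewrite labE.
  move: wfT; rewrite !well_formed_branch !well_formed_build !well_formed_branch.
  by case/and3P => -> /andP[-> /and3P[-> -> ->]] ->.
(* Summing [depthE] with weights and combining with minimality of [T] cancels the costs and leaves
   the two weights. *)
rewrite -(lerD2r (weight_on [set q in X | ~~ satisfies_outcome o1 q])).
move=> le_cost; rewrite -(lerD2l (cost_on T' X)); apply: le_trans le_cost.
rewrite /weight_on !sum_setId -!big_split; apply: ler_sum => q _ /=.
have mulr_b (b : bool) : (if b then weight I q else 0) = weight I q * b%:R.
  by case: b; rewrite ?mulr1 ?mulr0.
rewrite !mulr_b -!mulrDr -!natrD ler_wpM2l ?weight_ge0 // ler_nat.
exact: depthE.
Qed.

(** Induction along the path. The weight hypothesis is relative to the set [X] of queries at its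
    top, so that it can be restated for the path without its first test. *)
Lemma spine_meets s C X :
    optimal (build s C) X -> inhabited (build s C) X ->
    (if s is p :: _ then
       weight_on [set q in X | ~~ satisfies_outcome p.1 q]
         < weight_on [set q in X | follows s q]
     else true) ->
  pairwise (fun a b => meets (opposite a.1) b.1) s.
Proof.
elim: s X => [//|[o1 A1] s IHs] X opt inh /= light.
have XoE : [set q in [set q in X | satisfies_outcome o1 q] | follows s q] =
    [set q in X | follows ((o1, A1) :: s) q].
  by apply/setP => q; rewrite !inE andbA.
(* Each child of the node of [p] is reached by some query, and that query has followed all of
   [m]. *)
have both m p r : (o1, A1) :: s = m ++ p :: r ->
    all (fun a => meets a.1 p.1 && meets a.1 (opposite p.1)) m.
  move=> sE; move: inh; rewrite sE /build foldr_cat => /inhabited_build inhp.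
  have [|q] := inhabited_branch inhp (u := [::]); first exact: is_node_root.
  rewrite !inE => /andP[/andP[_ mq] pq] _.
  move: inhp; rewrite /= -branch_opposite => /inhabited_branch inhp.
  have [|q'] := inhp [::]; first exact: is_node_root.
  rewrite !inE => /andP[/andP[_ mq'] pq'] _.
  have : follows m q && follows m q' by rewrite mq.
  rewrite -all_predI; apply: sub_all => a /= /andP[aq aq'].
  by apply/andP; split; apply/existsP; [exists q | exists q']; rewrite ?aq ?aq'.
(* Otherwise [exchange] moves the test of [p] to the top. The queries following the whole path are
   among those saving a comparison, so their weight is at most that of the first side branch,
   against [light]. *)
have first m p r : s = m ++ p :: r ->
    all (fun a => ~~ meets (opposite a.1) (opposite p.1)) m ->
    meets (opposite o1) p.1.
  move=> sE nom; apply: contraLR light => no1p; rewrite -leNgt.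
  have := opt; rewrite sE /build /= foldr_cat /= => /exchange/(_ no1p nom).
  apply: le_trans; apply: weight_onS; apply/subsetP => q.
  rewrite !inE /follows /= all_cat => /andP[->] /=.
  by case/and4P => -> -> ->.
have pw : pairwise (fun a b => meets (opposite a.1) b.1) s.
  apply: (IHs [set q in X | satisfies_outcome o1 q]).
  - exact: optimal_branch opt.
  - exact: inhabited_branch inh.
  case: s {IHs} light both first opt XoE inh => [//|[o2 A2] s] light both first opt XoE _.
  (* It remains to see that the second side branch weighs no more than the first: [exchange] is
     applied with empty [m] to the outcome opposite to [o2], which misses the side of [o1]. *)
  rewrite XoE; apply: le_lt_trans light => /=.
  have m12 : meets (opposite o1) o2 by exact: (first [::] (o2, A2) s).
  have /andP[/andP[oo oo'] _] := both [:: (o1, A1)] (o2, A2) s erefl.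
  have nm := opposite_meets oo oo' m12.
  move: opt; rewrite /= -[branch o2 _ _]branch_opposite => opt.
  have := exchange (m := [::]) opt nm isT.
  apply: le_trans; rewrite le_eqVlt; apply/orP; left; apply/eqP; congr weight_on.
  by apply/setP => q; rewrite !inE /= satisfies_opposite andbA.
(* For every [a] in [m], [pw] and [both] give three consistent pairs with [p], so the two side
   outcomes are inconsistent, as [first] requires. *)
rewrite /= pw andbT; apply: all_splits => m p r sE.
apply: (first m p r sE); move: pw; rewrite sE pairwise_cat allrel_consr.
case/and3P => /andP[rel _] _ _.
have := both ((o1, A1) :: m) p r (congr1 (cons _) sE) => /= /andP[_ mtf].
have := conj rel mtf => /andP; rewrite -all_predI; apply: sub_all => a /=.
by case/and3P => am mt mf; apply: opposite_meets.
Qed.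

End Optimality.

(** * Edges of a tree and the queries crossing them *)

Section Edges.
Context {disp : Order.disp_t} {Q : finOrderType disp}.
Implicit Types (T S : tree Q) (u v : node) (o : outcome Q) (q : Q).

Lemma prefix_cat_search T u v S q : subtree T u = Some S ->
  prefix (u ++ v) (search T q) = prefix u (search T q) && prefix v (search S q).
Proof.
elim: u T => [|b u IHu] T.
  by rewrite subtree_root prefix0s => -[->].
case: T => [c|t Ty Tn] //= Tu; rewrite -andbA.
by case: b Tu => /IHu IH; case: (satisfies t q) => //=; rewrite IH.
Qed.

Lemma edge_outcomeP T u v o : edge_outcome T u v = Some o ->
  exists Ty Tn, subtree T u = Some (Node o.1 Ty Tn) /\ v = rcons u o.2.
Proof.
rewrite /edge_outcome; case: (subtree T u) => [[c|t Ty Tn]|] //.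
case: eqP => [-> [<-]|_]; first by exists Ty, Tn.
by case: eqP => // -> [<-]; exists Ty, Tn.
Qed.

Lemma edge_is_node T u v o : edge_outcome T u v = Some o -> is_node T v.
Proof.
move=> /edge_outcomeP[Ty [Tn [Tu ->]]].
by rewrite /is_node -cats1 subtree_cat Tu /=; case: o.2; rewrite subtree_root.
Qed.

Lemma prefix_edge T u v o q : edge_outcome T u v = Some o ->
  prefix v (search T q) = prefix u (search T q) && satisfies_outcome o q.
Proof.
move=> /edge_outcomeP[Ty [Tn [Tu ->]]]; rewrite -cats1 (prefix_cat_search _ _ Tu).
by rewrite /= prefix0s andbT eq_sym.
Qed.

Lemma childP T u v : child T u v -> exists o, edge_outcome T u v = Some o.
Proof. by rewrite /child; case: edge_outcome => // o _; exists o. Qed.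

End Edges.

(** * Consistency along a path of an optimal irreducible tree *)

Theorem theorem3 (R : realDomainType) (disp : Order.disp_t)
    (Q : finOrderType disp) (I : instance R Q) (T : tree Q)
    (T_tree : decision_tree I T)
    (T_irr : irreducible I T)
    (T_min : minimum_cost I T)
    (d : nat) (u : nat -> node) (u2' : node)
    (u_path : forall i : nat, (1 <= i < d)%N -> child T (u i) (u i.+1))
    (u2'_sibling : sibling T (u 2%N) u2')
    (u2'_light : node_weight I T u2' < node_weight I T (u d)) :
  forall i j : nat, (1 <= i < d)%N -> (1 <= j < d)%N -> i <> j ->
  forall (v : node) (o o' : outcome Q),
    edge_outcome T (u i) v = Some o ->
    edge_outcome T (u j) (u j.+1) = Some o' ->
    consistent o o'.
Proof.
move=> i j i_d j_d neq_ij v o o' edge_i edge_j.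
have prefix_u a b : (1 <= a <= b)%N -> (b <= d)%N -> prefix (u a) (u b).
  elim: b => [|b IHb]; first by lia.
  move=> /andP[a1]; rewrite leq_eqVlt => /predU1P[-> _|ab bd]; first exact: prefix_refl.
  have /childP[e /edge_outcomeP[_ [_ [_ ->]]]] : child T (u b) (u b.+1).
    by apply: u_path; lia.
  by apply: prefix_trans (prefix_rcons _ _); apply: IHb; lia.
have inh w : is_node T w -> exists q, prefix w (search T q).
  by move=> /T_irr[[q]]; rewrite inE; exists q.
(* When [u j] lies above [u i], any query reaching [v] has already taken the edge out of [u j]. *)
have [lt_ji|lt_ij] : (j < i)%N \/ (i < j)%N by lia.
  have [q vq] := inh v (edge_is_node edge_i); exists q.
  move: (vq); rewrite (prefix_edge _ edge_i) => /andP[uq ->]; split=> //.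
  have: prefix (u j.+1) (search T q) by apply: prefix_trans uq; apply: prefix_u; lia.
  by rewrite (prefix_edge _ edge_j) => /andP[].
have [v_next|v_side] := eqVneq v (u i.+1).
  have [q uq] := inh _ (edge_is_node edge_j); exists q.
  have: prefix v (search T q).
    by rewrite v_next; apply: prefix_trans uq; apply: prefix_u; lia.
  by move: uq; rewrite (prefix_edge _ edge_i) (prefix_edge _ edge_j) => /andP[_ ->] /andP[].
(* The answers along the path below [u 1]. Nodes are numbered from 1 and answers from 0: answer [k]
   leads from [u k.+1] to [u k.+2]. *)
pose bs := mkseq (fun k => last true (u k.+2)) d.-1.
have size_bs : size bs = d.-1 by rewrite size_mkseq.
have uE k : (k < d)%N -> u k.+1 = u 1 ++ take k bs.
  elim: k => [|k IHk] kd; first by rewrite take0 cats0.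
  have /childP[e /edge_outcomeP[_ [_ [_ ue]]]] : child T (u k.+1) (u k.+2).
    by apply: u_path; lia.
  rewrite (take_nth true) ?size_bs; last by lia.
  rewrite -rcons_cat -IHk; last by lia.
  by rewrite nth_mkseq ?ue ?last_rcons //; lia.
have u_next k : (k.+1 < d)%N -> u k.+2 = rcons (u k.+1) (nth true bs k).
  move=> kd; rewrite (uE k.+1) // (uE k); last by lia.
  by rewrite (take_nth true) ?rcons_cat // size_bs; lia.
have [e1 edge_1] : exists e, edge_outcome T (u 1) (u 2) = Some e.
  by apply/childP/u_path; lia.
have [Ty [Tn [Tu1 u2E]]] := edge_outcomeP edge_1.
set S := Node _ _ _ in Tu1.
have udE : u d = u 1 ++ bs.
  by rewrite -[bs]take_size size_bs -uE ?prednK //; lia.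
have [e2 edge_d] : exists e, edge_outcome T (u d.-1) (u d) = Some e.
  by have := u_path d.-1; rewrite prednK; [move=> H; apply/childP/H; lia | lia].
have bs_node : is_node S bs.
  by have := edge_is_node edge_d; rewrite udE /is_node subtree_cat Tu1.
have [C SC] : exists C, subtree S bs = Some C.
  by move: bs_node; rewrite /is_node; case: subtree => // C _; exists C.
pose X := queries_at T (u 1).
have optS : optimal I S X.
  have := optimal_subtree (optimal_root T_tree T_min) Tu1.
  by congr optimal; apply/setP => q; rewrite !inE.
have inhS : inhabited S X.
  move=> w Sw; have [|q uq] := inh (u 1 ++ w).
    by rewrite /is_node subtree_cat Tu1.
  by exists q; move: uq; rewrite ?inE (prefix_cat_search _ _ Tu1) => /andP[].
have spine_nth k : (k.+1 < d)%N -> forall e w, edge_outcome T (u k.+1) w = Some e ->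
    (nth (o, S) (spine S bs) k).1 = (e.1, nth true bs k).
  move=> kd e w /edge_outcomeP[x [y [Tuk _]]].
  have Suk : subtree S (take k bs) = Some (Node e.1 x y).
    by move: Tuk; rewrite uE ?subtree_cat ?Tu1 //; lia.
  by apply: nth_spine Suk => //; rewrite size_bs; lia.
have pw : pairwise (fun a b => meets (opposite a.1) b.1) (spine S bs).
  move: optS inhS; rewrite {1 2}(build_spine SC) => /spine_meets/[apply]; apply.
  have follows_ud : [set q in X | follows (spine S bs) q] = queries_at T (u d).
    apply/setP => q; rewrite !inE udE (prefix_cat_search _ _ Tu1).
    by rewrite -prefix_search.
  rewrite follows_ud.
  have d1 : (1 < d)%N by lia.
  have := spine_nth 0 d1 _ _ edge_1.
  case: (spine S bs) => [//|p s] /= pE.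
  move: u2'_light; rewrite /node_weight /weight_on.
  congr (_ < _); apply: eq_bigl => q.
  (* The common parent [w] must be [u 1], so the edge to [u2'] carries the other answer to the first
     test of the spine. *)
  have [neq_u2 [w [/childP[f1 edge_u2] /childP[f2 edge_u2']]]] := u2'_sibling.
  have [x1 [y1 [_ u2f]]] := edge_outcomeP edge_u2.
  have [x2 [y2 [Tw u2'f]]] := edge_outcomeP edge_u2'.
  have [wE f1E] := rcons_inj (etrans (esym (u_next 0 d1)) u2f).
  move: edge_u2' Tw; rewrite -wE Tu1 => edge_u2' [f2E _ _].
  rewrite !inE (prefix_edge _ edge_u2') pE f2E; congr (_ && _).
  rewrite -satisfies_opposite /opposite /= f1E; congr satisfies_outcome.
  move: neq_u2; rewrite u2f u2'f eqseq_rcons eqxx /=.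
  by case: (f2) => s' [] /=; case: f1.2.
(* In the remaining case [v] is off the path and [u i] above [u j]; then [o] is opposite to the path
   outcome at [u i], which is what [pw] treats. Indices are shifted to start at 0. *)
move: i j i_d j_d {neq_ij} lt_ij edge_i edge_j v_side => [|i] [|j] // i_d j_d lt_ij.
move=> edge_i edge_j v_side.
have size_sp : size (spine S bs) = d.-1 by rewrite size_spine.
have /(pairwiseP (o, S))/(_ i j) := pw; rewrite !inE size_sp => /(_ _ _ lt_ij).
rewrite (spine_nth i _ _ _ edge_i) ?(spine_nth j _ _ _ edge_j) //; try lia.
have [i_sp j_sp] : (i < d.-1)%N /\ (j < d.-1)%N by lia.
move=> /(_ i_sp j_sp)/meetsP; congr consistent.
  have [_ [_ [_ vE]]] := edge_outcomeP edge_i.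
  move: v_side; rewrite vE u_next // eqseq_rcons eqxx /=.
  by rewrite /opposite /=; case: (o) => s [] /=; case: (nth _ _ _).
have [_ [_ [_]]] := edge_outcomeP edge_j; rewrite u_next // => /rcons_inj[->].
by case: (o').
Qed.
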